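(* Let $O$ be a nilpotent adjoint orbit of $\mathfrak{sl}_n(\mathbb C)$ whose Jordan partition $(p_1,\dots,p_s)$ of $n$ satisfies $|p_i-p_j|\le1$ for all $1\le i,j\le s$. Then $O$ is conormal. More precisely, let $e\in O$ and let $(h^+,e,f)$ be an $\mathfrak{sl}_2$-triple. Then there exists a Lie subalgebra $\mathfrak s$ of $\mathfrak{sl}_n(\mathbb C)$ such that $\mathfrak s$ is $\operatorname{ad}h^+$-invariant and $\mathfrak{sl}_n(\mathbb C)=\mathfrak g^e\oplus\mathfrak s$.
   Context: Nilpotent orbits of $\mathfrak{sl}_n(\mathbb C)$ correspond to partitions $p_1\ge\dots\ge p_s$ of $n$, given by the Jordan block sizes. $\mathfrak g^e$ denotes the centralizer of $e$. The hypothesis covers partitions of the form $(p^r)$ and $(p^r,(p-1)^s)$; in particular it covers the regular orbit and the spherical orbits $(2^a,1^b)$. *)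

(* Defs.v *)
From HB Require Import structures.
From mathcomp Require Import all_boot all_order all_algebra.
From mathcomp Require Import complex.
From mathcomp Require Import reals.
Set Implicit Arguments. Unset Strict Implicit. Unset Printing Implicit Defensive.
Import Order.TTheory GRing.Theory Num.Theory.
Local Open Scope ring_scope.

Definition block_ends (p : seq nat) : seq nat := scanl addn 0%N p.

(* The nilpotent Jordan matrix with Jordan blocks of sizes p_1, ..., p_s
   (in this order along the diagonal): entry (i, i+1) is 1 unless i+1 is
   the start of a new block, all other entries are 0. *)
Definition jordan_nil (F : nzRingType) (n : nat) (p : seq nat) : 'M[F]_n :=
  \matrix_(i < n, j < n)
    (((j : nat) == i.+1) && (i.+1 \notin block_ends p))%:R.

Definition is_partition (n : nat) (p : seq nat) : bool :=
  [&& all (fun k => 0 < k)%N p, sorted geq p & sumn p == n].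

(* e lies in the nilpotent orbit with Jordan partition p (conjugacy under
   GL_n, which has the same orbits on sl_n as the adjoint group SL_n). *)
Definition in_nilorbit (F : fieldType) (n : nat) (p : seq nat) (e : 'M[F]_n) :=
  exists2 P : 'M[F]_n, P \in unitmx & e = invmx P *m jordan_nil F n p *m P.

Definition lie (F : nzRingType) (n : nat) (x y : 'M[F]_n) : 'M[F]_n :=
  x *m y - y *m x.

Definition in_sl (F : nzRingType) (n : nat) (x : 'M[F]_n) : Prop := \tr x = 0.

Definition sl2_triple (F : nzRingType) (n : nat) (h e f : 'M[F]_n) : Prop :=
  [/\ in_sl h, in_sl e & in_sl f] /\
  [/\ lie h e = 2%:R *: e, lie h f = - (2%:R *: f) & lie e f = h].

Definition in_centralizer (F : nzRingType) (n : nat) (e x : 'M[F]_n) : Prop :=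
  in_sl x /\ lie x e = 0.

(* Main.v *)
Require Import Defs.
From HB Require Import structures.
From mathcomp Require Import all_boot all_order all_algebra.
From mathcomp Require Import complex.
From mathcomp Require Import reals.
From mathcomp Require Import ring zify.
Import Order.TTheory GRing.Theory Num.Theory.
Local Open Scope ring_scope.

(** Matrices act on row vectors. Let m be the largest part of p. That all
    blocks have size m or m - 1 is encoded by e^m = 0 together with
    1 = e^k X + Y e^l whenever k + l = m - 1, i.e. ker e^k <= im e^l. Through
    the commutation formula for e^k f this forces h to be diagonalizable, its
    eigenspaces U0 and U1 for the weights m - 1 and m - 2 generating F^n freely
    under e, subject only to U0 e^m = 0 and U1 e^(m-1) = 0. So an endomorphism
    commuting with e amounts to a pair of maps U0 -> F^n and U1 -> ker e^(m-1).
    As ker e^(m-1) is a complement of U0, the associative algebra of all x with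
    U0 x = 0 and U1 x <= U0 is a complement in gl_n of the commutant of e. It is
    ad h-stable because U0 and U1 are h-stable. *)

(** * Spectral projections by Lagrange interpolation *)

Lemma spectral_projections (F : fieldType) (A : algType F) (N : nat)
    (a : nat -> F) (x : A) :
    (0 < N)%N -> injective a -> \prod_(j < N) (x - (a j)%:A) = 0 ->
  exists P : nat -> A,
    [/\ \sum_(j < N) P j = 1, forall j, x * P j = a j *: P j,
        forall j, P j * x = a j *: P j, forall j, (N <= j)%N -> P j = 0
      & forall i j, P i * P j = if i == j then P i else 0].
Proof.
move=> N0 ainj px0.
pose L (j : 'I_N) : {poly F} := tnth (lagrange N a) j.
(* The Lagrange basis polynomials at the nodes [a], evaluated at [x]. The value 0 from [N] on lets
   later index shifts go without bounds. *)
pose P j := if insub j is Some i then horner_alg x (L i) else 0.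
have xP j : x * P j = a j *: P j.
  rewrite /P; case: insubP => [i _ <-|_]; last by rewrite mulr0 scaler0.
  have Li0 : ('X - (a i)%:P) * L i
      = (\prod_(k < N | k != i) ('X - (a k)%:P)).[a i]^-1
        *: \prod_(k < N) ('X - (a k)%:P).
    rewrite /L lagrangeE // mulrCA mul_polyC; congr (_ *: _).
    by rewrite [RHS](bigD1 i).
  have: horner_alg x (('X - (a i)%:P) * L i) = 0.
    rewrite Li0 linearZ /= rmorph_prod /=.
    rewrite (eq_bigr (fun k : 'I_N => x - (a k)%:A)) ?px0 ?mulr0 ?scaler0 // => k _.
    by rewrite rmorphB /= horner_algX horner_algC.
  rewrite rmorphM rmorphB /= horner_algX horner_algC mulrBl mulr_algl.
  by move/eqP; rewrite subr_eq0 => /eqP.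
have Px j : P j * x = a j *: P j.
  rewrite -xP /P; case: insub => [i|]; last by rewrite mul0r mulr0.
  by have /(congr1 (horner_alg x)) := mulrC (L i) 'X;
     rewrite !rmorphM /= horner_algX.
have sumP : \sum_(j < N) P j = 1.
  have := @lagrange_gen F N a N0 ainj 1.
  rewrite size_poly1 => /(_ N0)/(congr1 (horner_alg x)).
  rewrite rmorph1 rmorph_sum => ->; apply: eq_bigr => j _ /=.
  by rewrite /P valK hornerC polyC1 mul1r.
have orth i j : i != j -> P i * P j = 0.
  move=> ij; have: P i * x * P j = P i * (x * P j) by rewrite mulrA.
  rewrite Px xP -scalerAl -scalerAr => /eqP; rewrite -subr_eq0 -scalerBl.
  by rewrite scaler_eq0 subr_eq0 (inj_eq ainj) (negPf ij) => /eqP.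
have P0 j : (N <= j)%N -> P j = 0 by move=> ?; rewrite /P insubF //; lia.
exists P; split=> // i j; case: eqVneq => [<-|/orth//].
have [Ni|iN] := leqP N i; first by rewrite P0 ?mul0r.
rewrite -[RHS]mulr1 -sumP mulr_sumr (bigD1 (Ordinal iN)) //= big1 ?addr0 // => k.
by rewrite -val_eqE eq_sym => /orth.
Qed.

(** * Commutation relations and diagonalizability of [h] *)

Section SL2.

Variables (F : numFieldType) (A : algType F) (h e f : A) (d : nat).

Hypothesis he : h * e = e * h + e *+ 2.
Hypothesis ef : e * f = f * e + h.

Lemma mul_h_exp m : h * e ^+ m = e ^+ m * h + e ^+ m *+ m.*2.
Proof.
elim: m => [|m IH]; first by rewrite mul1r mulr1 addr0.
rewrite exprSr mulrA IH mulrDl -mulrA he mulrDr mulrA -addrA; congr (_ + _).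
by rewrite mulrnAr mulrnAl -mulrnDr; congr (_ *+ _); lia.
Qed.

Lemma exp_mul_f m :
  e ^+ m.+1 * f = f * e ^+ m.+1 + (e ^+ m * h + e ^+ m *+ m) *+ m.+1.
Proof.
elim: m => [|m IH]; first by rewrite expr1 ef mul1r addr0.
rewrite [in LHS]exprSr -mulrA ef mulrDr mulrA IH mulrDl -mulrA -exprSr -addrA.
congr (_ + _).
rewrite mulrnAl mulrDl -mulrA he mulrDr mulrA -exprSr mulrnAl mulrnAr -exprSr.
by rewrite -addrA -mulrnDr !mulrnDl addrAC -mulrSr; congr (_ + _).
Qed.

Hypothesis nil_e : e ^+ d.+2 = 0.

(* The largest Jordan block has size d + 2, so d + 1 is the highest weight. *)
Definition wt (j : nat) : F := d.+1%:R - j%:R.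

Lemma wt_inj : injective wt.
Proof. by move=> i j /addrI/oppr_inj/eqP; rewrite eqr_nat => /eqP. Qed.

Lemma exp_top_h : e ^+ d.+1 * h = - (d.+1%:R *: e ^+ d.+1).
Proof.
have := exp_mul_f d.+1; rewrite nil_e mul0r mulr0 add0r => /esym/eqP.
rewrite -scaler_nat scaler_eq0 pnatr_eq0 /= addr_eq0 => /eqP ->.
by rewrite scaler_nat.
Qed.

Lemma h_exp_top : h * e ^+ d.+1 = wt 0 *: e ^+ d.+1.
Proof.
rewrite mul_h_exp exp_top_h -[_ *+ d.+1.*2]scaler_nat -scaleNr -scalerDl.
by congr (_ *: _); rewrite /wt -addnn natrD; ring.
Qed.

Hypothesis split_e :
  forall k l, (k + l)%N = d.+1 -> exists X Y, 1 = e ^+ k * X + Y * e ^+ l.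

Lemma factor_exp k l X : (k + l)%N = d.+1 -> X * e ^+ k = 0 ->
  exists W, X = W * e ^+ l.
Proof.
move=> /split_e[U [V eq1]] X0; exists (X * V).
by rewrite -[LHS]mulr1 eq1 mulrDr mulrA X0 mul0r add0r mulrA.
Qed.

(** Modulo im e only the two top weights occur. The factor [w] kills [e ^+ d.+1], so multiplying the
    formula for [e ^+ d.+1 * f] by [w] on the left gives [(w f e + (d+1) w v) e^d = 0]. As ker e^d
    <= im e, the bracket is a left multiple of [e], and hence so is [w * v]. *)
Lemma h_top_quadratic : exists B, (h - (wt 0)%:A) * (h - (wt 1)%:A) = B * e.
Proof.
set w := h - _; set v := h - _.
have we : w * e ^+ d.+1 = 0 by rewrite mulrBl h_exp_top mulr_algl subrr.
have ve : e ^+ d * h + e ^+ d *+ d = v * e ^+ d.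
  rewrite mulrBl mul_h_exp mulr_algl -addrA -scaler_nat; congr (_ + _).
  rewrite -[_ *+ d.*2]scaler_nat -scalerBl; congr (_ *: _).
  by rewrite /wt -addnn natrD -natr1; ring.
have Z0 : (w * f * e + (w * v) *+ d.+1) * e ^+ d = 0.
  rewrite mulrDl -!mulrA -exprS mulrnAl -mulrA -mulrnAr -mulrDr -ve.
  by rewrite -exp_mul_f mulrA we mul0r.
have [W WE] := factor_exp d 1 _ (addn1 d) Z0; rewrite expr1 in WE.
exists (d.+1%:R^-1 *: (W - w * f)).
rewrite -scalerAl [_ * e]mulrBl -WE addrAC subrr add0r -scaler_nat scalerA.
by rewrite mulVf ?scale1r ?pnatr_eq0.
Qed.

Lemma prod_h : \prod_(j < d.+2.*2) (h - (wt j)%:A) = 0.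
Proof.
have [B hB] := h_top_quadratic.
have eh m i : e ^+ m * (h - (wt (i + m.*2))%:A) = (h - (wt i)%:A) * e ^+ m.
  rewrite mulrBl mul_h_exp mulrBr mulr_algl mulr_algr -addrA; congr (_ + _).
  rewrite -[_ *+ m.*2]scaler_nat -scaleNr -scalerBl; congr (_ *: _).
  by rewrite /wt natrD; ring.
(* Moving [e ^+ k] to the right past the next two factors turns them into the quadratic of
   [h_top_quadratic], which yields one more [e]. *)
have H k : exists X, \prod_(j < k.*2) (h - (wt j)%:A) = X * e ^+ k.
  elim: k => [|k [X IH]]; first by exists 1; rewrite big_ord0 mulr1.
  rewrite doubleS !big_ord_recr /= IH; exists (X * B).
  have := eh k 0; have := eh k 1; rewrite add0n add1n => eh1 eh0.
  rewrite -[X * _ * _]mulrA eh0 -!mulrA eh1 [(h - _) * (_ * _)]mulrA hB.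
  by rewrite -mulrA -exprS.
by have [X ->] := H d.+2; rewrite nil_e mulr0.
Qed.

(** * Weight spaces of [h] and the commutant of [e] *)

Variable P : nat -> A.

Hypotheses (sumP : \sum_(j < d.+2.*2) P j = 1)
  (hP : forall j, h * P j = wt j *: P j)
  (Ph : forall j, P j * h = wt j *: P j)
  (P_out : forall j, (d.+2.*2 <= j)%N -> P j = 0)
  (PP : forall i j, P i * P j = if i == j then P i else 0).

(** On row vectors, [u h = w u] gives [u e h = (w - 2) u e]: here [e] lowers the weight by two and
    so raises the index by two. *)
Lemma P_e_P i j : j != i.+2 -> P i * e * P j = 0.
Proof.
move=> ji; have /eqP: P i * h * e * P j = P i * (e * h + e *+ 2) * P j.
  by rewrite -[P i * h * e]mulrA he.
rewrite Ph mulrDr mulrDl mulrA -[P i * e * h * _]mulrA hP.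
rewrite -!(scalerAl, scalerAr) mulrnAr mulrnAl -[_ *+ 2]scaler_nat -scalerDl.
rewrite -subr_eq0 -scalerBl scaler_eq0 => /orP[|/eqP//].
rewrite (_ : wt i - _ = j%:R - i.+2%:R).
  by rewrite subr_eq0 eqr_nat (negPf ji).
by rewrite /wt -[in RHS]addn2 natrD; ring.
Qed.

Lemma P_e j : P j * e = e * P j.+2.
Proof.
have -> : P j * e = P j * e * P j.+2.
  rewrite -[LHS]mulr1 -sumP mulr_sumr.
  have [jN|Nj] := ltnP j.+2 d.+2.*2.
    rewrite (bigD1 (Ordinal jN)) //= big1 ?addr0 // => i.
    by rewrite -val_eqE /= => /P_e_P.
  rewrite (P_out j.+2) // mulr0 big1 // => i _; apply: P_e_P.
  by have := ltn_ord i; lia.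
rewrite -[RHS]mul1r -sumP mulr_suml.
have [jN|Nj] := ltnP j d.+2.*2; last first.
  rewrite (P_out j.+2) ?mulr0 ?big1 // => [i _|]; first by rewrite !mulr0.
  exact: leqW (leqW Nj).
rewrite (bigD1 (Ordinal jN)) //= big1 ?addr0 ?mulrA // => i.
by rewrite -val_eqE /= mulrA => ij; rewrite P_e_P //; lia.
Qed.

Lemma e_P_low j : (j < 2)%N -> e * P j = 0.
Proof.
move=> j2; rewrite -[LHS]mul1r -sumP mulr_suml big1 // => i _.
by rewrite mulrA P_e_P //; lia.
Qed.

Lemma P_exp_top j : (0 < j)%N -> P j * e ^+ d.+1 = 0.
Proof.
move=> j0; have: P j * h * e ^+ d.+1 = P j * (h * e ^+ d.+1) by rewrite mulrA.
rewrite Ph h_exp_top -scalerAl -scalerAr => /eqP; rewrite -subr_eq0 -scalerBl.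
rewrite scaler_eq0 subr_eq0 (inj_eq wt_inj) => /orP[|/eqP//].
by move: j0; case: j.
Qed.

(** Since ker e <= im e^d, write [X = W e^d] and expand [0 = W e^(d+1) f]. Right multiplication by
    [h + (d+1)] removes the term in [f e^(d+1)] and leaves [X] times
    [(d+1)(wt j + d)(wt j + d + 1)], nonzero for [j <= 2d]. *)
Lemma e_cancel j X : X * P j = X -> X * e = 0 -> (j <= d.*2)%N -> X = 0.
Proof.
move=> XP Xe jd; have Xh : X * h = wt j *: X.
  by rewrite -{1}XP -mulrA Ph -scalerAr XP.
have /factor_exp-/(_ X)[|W XE] := add1n d; first by rewrite expr1.
have: W * (e ^+ d.+1 * f) = 0 by rewrite mulrA exprSr mulrA -XE Xe mul0r.
rewrite exp_mul_f mulrDr mulrnAr mulrDr mulrnAr !mulrA -XE Xh.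
rewrite -[X *+ d]scaler_nat -scalerDl -[_ *+ d.+1]scaler_nat scalerA.
move/(congr1 (fun Y => Y * h + d.+1%:R *: Y)); rewrite mul0r scaler0 addr0.
rewrite mulrDl -mulrA exp_top_h mulrN -scalerAr scalerDr addrACA addNr add0r.
rewrite -scalerAl Xh !scalerA -scalerDl => /eqP.
rewrite scaler_eq0 => /orP[|/eqP//].
rewrite [_ * wt j]mulrC -mulrDl !mulf_eq0 pnatr_eq0 /=.
have -> : wt j + d.+1%:R = (d.+1.*2 - j)%:R.
  have jd' : (j <= d.+1.*2)%N by lia.
  by rewrite natrB // -addnn natrD /wt addrAC.
have -> : wt j + d%:R = (d.*2.+1 - j)%:R.
  have jd' : (j <= d.*2.+1)%N by exact: leqW.
  by rewrite natrB // -addnn -addSn natrD /wt addrAC.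
by rewrite !pnatr_eq0 => /orP[]; lia.
Qed.

Lemma exp_cancel k j X :
  X * P j = X -> X * e ^+ k = 0 -> (j + k.*2 <= d.+1.*2)%N -> X = 0.
Proof.
elim: k j X => [|k IH] j X XP; first by rewrite mulr1.
rewrite exprS mulrA => Xe jk; apply: (e_cancel j) => //; last by lia.
apply: (IH j.+2) => //; last by lia.
by rewrite -mulrA -P_e mulrA XP.
Qed.

(** Below the two top weights the quadratic of [h_top_quadratic] acts as a nonzero scalar, so these
    weight spaces lie in im e. *)
Lemma lower_P : exists C : nat -> A, forall i, P i.+2 = C i * e.
Proof.
have [B BE] := h_top_quadratic.
exists (fun i =>
  ((wt i.+2 - wt 0) * (wt i.+2 - wt 1))^-1 *: (P i.+2 * B)) => i.
rewrite -scalerAl -mulrA -BE mulrA [P _ * _]mulrBr Ph mulr_algr -scalerBl -scalerAl.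
rewrite [P _ * _]mulrBr Ph mulr_algr -scalerBl !scalerA -mulrA mulVf ?scale1r //.
by rewrite mulf_neq0 ?subr_eq0 ?(inj_eq wt_inj).
Qed.

(** [B k] lifts the weight space of index [i + 2k] back into that of index [i], as a section of
    [e ^+ k]; for [i < 2] this is generation by U0 and U1. *)
Lemma exp_section i : exists B : nat -> A, B 0%N = P i /\ forall k,
  [/\ P (i + k.*2)%N * B k = B k, B k * P i = B k
    & B k * e ^+ k = P (i + k.*2)%N].
Proof.
have [C CE] := lower_P.
exists (nat_rect (fun=> A) (P i)
  (fun k Bk => P (i + k.*2).+2 * C (i + k.*2)%N * Bk)); split=> //.
elim=> [|k]; first by rewrite addn0 /= PP eqxx mulr1.
rewrite doubleS !addnS /=; move: (nat_rect _ _ _ _) (i + k.*2)%N => B j.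
case=> PB BP BE; split; first by rewrite !mulrA PP eqxx.
  by rewrite -mulrA BP.
rewrite exprSr !mulrA -[_ * B * _]mulrA BE -mulrA P_e mulrA.
by rewrite -[_ * C _ * _]mulrA -CE !(PP, eqxx).
Qed.

(** The extension lifts a row to index [i] by [B k], applies [x], and pushes down again by [e ^+ k].
    The condition on [x] matches the relation [Ui e^(d+2-i) = 0]. *)
Lemma extend_commuting i x : (i < 2)%N -> x * e ^+ (d.+2 - i) = 0 ->
  exists2 z, z * e = e * z &
    forall j, (j < 2)%N -> P j * z = if j == i then P i * x else 0.
Proof.
move=> i2 xe; have [B [B0 BE]] := exp_section i.
have e_B k : (i + k.+1.*2 <= d.+1.*2)%N -> e * B k.+1 = B k.
  move=> ik; apply/eqP; rewrite -subr_eq0; apply/eqP.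
  have [_ BP Be] := BE k; have [_ BP' Be'] := BE k.+1.
  apply: (@exp_cancel k.+1 i) => //; first by rewrite mulrBl -mulrA BP' BP.
  by rewrite mulrBl -mulrA Be' exprSr mulrA Be doubleS !addnS P_e subrr.
exists (\sum_(k < d.+2) B k * x * e ^+ k).
  rewrite mulr_suml mulr_sumr big_ord_recr [RHS]big_ord_recl /= B0.
  rewrite !mulrA e_P_low // !mul0r add0r.
  have -> : B d.+1 * x * e ^+ d.+1 * e = 0.
    by rewrite -mulrA -exprSr nil_e mulr0.
  rewrite addr0; apply: eq_bigr => k _.
  rewrite /bump leq0n add1n -mulrA -exprSr.
  have [ik|ik] := leqP (i + k.+1.*2) d.+1.*2; first by rewrite !mulrA e_B.
  (* Only [i = 1], [k = d] remains, exactly where the hypothesis on [x] applies. *)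
  have {}xe : x * e ^+ k.+1 = 0.
    by rewrite -[k.+1](@subnK (d.+2 - i)) 1?addnC ?exprD ?mulrA ?xe ?mul0r //; lia.
  by rewrite -!mulrA xe !mulr0.
move=> j j2; rewrite mulr_sumr big_ord_recl big1 /= => [|k _].
  by rewrite addr0 mulr1 B0 mulrA PP; case: eqP => [->|]; rewrite ?mul0r.
have [PB _ _] := BE k.+1.
by rewrite /bump leq0n add1n -PB !mulrA PP ifN ?mul0r //; lia.
Qed.

(** As [U1 e^(d+1) = 0], the image U1 y lies in ker e^(d+1), which meets U0 trivially. So [y] kills
    both U0 and U1, hence everything they generate. *)
Lemma commuting_eq0 y : P 0%N * y = 0 -> P 1%N * y * (1 - P 0%N) = 0 ->
    y * e = e * y ->
  y = 0.
Proof.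
move=> y0 y1 ye.
have yexp k : y * e ^+ k = e ^+ k * y by apply: commrX.
have {}y1 : P 1%N * y = 0.
  apply: (@exp_cancel d.+1 0%N); last by rewrite add0n.
    by apply/eqP; rewrite eq_sym -subr_eq0 -{1}[_ * y]mulr1 -mulrBr y1.
  by rewrite -mulrA yexp mulrA P_exp_top ?mul0r.
have [C CE] := lower_P.
have Py j : P j * y = 0.
  have [m] := ubnP j; elim: m j => // m IH [|[|j]] // jm.
  have -> : P j.+2 = C j * P j * e.
    by rewrite -mulrA P_e mulrA -CE PP eqxx.
  by rewrite -mulrA -ye mulrA -[C j * _ * _]mulrA IH ?mulr0 ?mul0r //; lia.
by rewrite -[y]mul1r -sumP mulr_suml big1.
Qed.

Lemma commuting_decomposition x : exists z,
  [/\ z * e = e * z, P 0%N * (x - z) = 0 & P 1%N * (x - z) * (1 - P 0%N) = 0].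
Proof.
have P01 : P 0%N * (1 - P 0%N) = 0 by rewrite mulrBr mulr1 PP subrr.
have [||z0 z0e Pz0] := @extend_commuting 0%N x; rewrite ?subn0 ?nil_e ?mulr0 //.
(* Applying [1 - P 0] moves the values on U1 into ker e^(d+1), as the extension requires; the error
   made lies in U0. *)
have [||z1 z1e Pz1] := @extend_commuting 1%N (x * (1 - P 0%N)) => //.
  have -> : 1 - P 0%N = \sum_(1 <= j < d.+2.*2) P j.
    by rewrite -[1 in LHS]sumP -(big_mkord xpredT P) big_ltn //= addrAC subrr add0r.
  rewrite subn1 -mulrA mulr_suml big_nat big1 ?mulr0 // => j /andP[j0 _].
  exact: P_exp_top.
exists (z0 + z1); split; first by rewrite mulrDl mulrDr z0e z1e.
  by rewrite mulrBr mulrDr Pz0 // Pz1 //= addr0 subrr.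
have -> : P 1%N * (x - (z0 + z1)) = P 1%N * x * P 0%N.
  rewrite mulrBr mulrDr Pz0 // Pz1 //= add0r mulrBr mulr1 mulrBr mulrA.
  by rewrite opprB addrC subrK.
by rewrite -mulrA P01 mulr0.
Qed.

End SL2.

(** * Powers of a Jordan matrix *)

Definition same_block (s : seq nat) (i j : nat) : bool :=
  ~~ has (fun x => i < x <= j)%N (block_ends s).

Lemma same_block_trans s i j k : (i <= j <= k)%N ->
  same_block s i k = same_block s i j && same_block s j k.
Proof.
move=> ijk; rewrite /same_block -negb_or -has_predU; congr (~~ _).
by apply: eq_has => x /=; lia.
Qed.

Lemma mem_scanl_addn c s x : x \in scanl addn c s -> (c <= x)%N.
Proof.
elim: s c => //= m s IH c; rewrite inE => /orP[/eqP->|/IH]; first exact: leq_addr.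
exact/leq_trans/leq_addr.
Qed.

(** The end at [a + m] makes high powers vanish; the last clause keeps [same_block] true throughout
    [[a, a + m)]. *)
Lemma block_interval s i : (i < sumn s)%N -> exists a m,
  [/\ m \in s, (a <= i < a + m)%N, (a + m <= sumn s)%N, a + m \in block_ends s
    & forall x, x \in block_ends s -> (x <= a)%N || (a + m <= x)%N]%N.
Proof.
suff H c : (c <= i < c + sumn s)%N -> exists a m,
  [/\ m \in s, (c <= a <= i)%N && (i < a + m <= c + sumn s)%N,
      a + m \in scanl addn c s
    & forall x, x \in scanl addn c s -> (x <= a)%N || (a + m <= x)%N]%N.
  move=> /(H 0%N)[a [m [? ? ? ?]]]; exists a, m; split=> //; lia.
elim: s c => [|m s IH] c /=; first lia.
move=> ci; have [im|mi] := ltnP i (c + m).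
  exists c, m; split; rewrite ?mem_head //; first lia.
  move=> x; rewrite inE => /orP[/eqP->|/mem_scanl_addn->]; last exact: orbT.
  by rewrite leqnn orbT.
have [|a [m' [m's ai am ends]]] := IH (c + m)%N; first lia.
exists a, m'; split; rewrite ?inE ?m's ?am ?orbT //; first lia.
by move=> x; rewrite inE => /orP[/eqP->|/ends//]; lia.
Qed.

(** Evaluates an entry of a product of 0-1 matrices whose left factor has at most one 1 per row. *)
Lemma sum_indicator (R : nzRingType) n t (P Q : pred nat) :
  \sum_(m < n) ((m == t :> nat) && P m)%:R * (Q m)%:R
    = [&& t < n, P t & Q t]%N%:R :> R.
Proof.
transitivity (\sum_(m < n | m == t :> nat) (P m && Q m)%:R : R).
  rewrite [RHS]big_mkcond; apply: eq_bigr => m _.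
  by case: eqP => _; rewrite ?mul0r // -natrM mulnb.
by rewrite (big_ord1_eq _ (fun m => (P m && Q m)%:R)); case: ltnP.
Qed.

Section Jordan.

Variables (F : nzRingType) (n : nat) (s : seq nat).
Hypothesis sum_s : sumn s = n.+1.

Local Notation J := (jordan_nil F n.+1 s).

Lemma jordan_exp k :
  J ^+ k = \matrix_(i, j) (((j : nat) == i + k)%N && same_block s i j)%:R.
Proof.
elim: k => [|k IH].
  apply/matrixP => i j; rewrite !mxE addn0 -val_eqE eq_sym /=.
  case: eqP => //= ->; rewrite /same_block (eq_has (a2 := pred0)) ?has_pred0 // => x.
  by rewrite /=; lia.
rewrite exprSr IH; apply/matrixP => i j; rewrite !mxE.
under eq_bigr => m _ do rewrite !mxE.
rewrite (sum_indicator _ _ _ (same_block s i)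
  (fun m => (j == m.+1 :> nat) && (m.+1 \notin block_ends s))) addnS.
case: eqP => [jik|]; rewrite ?andbF // !andTb; congr (_%:R); congr nat_of_bool.
rewrite [in RHS](same_block_trans s i (i + k)) ?jik; last by lia.
have -> : (i + k < n.+1)%N by have := ltn_ord j; lia.
rewrite andTb; congr (_ && _); rewrite /same_block -has_pred1; congr (~~ _).
by apply: eq_has => x /=; lia.
Qed.

Lemma jordan_exp_eq0 k : (forall m, m \in s -> (m <= k)%N) -> J ^+ k = 0.
Proof.
move=> sk; rewrite jordan_exp; apply/matrixP => i j; rewrite !mxE.
case: eqP => //= jik; have [|a [m [/sk mk ai _ am _]]] := block_interval s i.
  by rewrite sum_s.
by rewrite /same_block (_ : has _ _) //; apply/hasP; exists (a + m)%N => //; lia.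
Qed.

(* Row i of the identity factors through J^k on the left if i + k lies in the
   block of i; otherwise i - l does, since blocks have size at least k + l. *)
Lemma jordan_split k l : (forall m, m \in s -> (k + l <= m)%N) ->
  exists X Y, 1 = J ^+ k * X + Y * J ^+ l.
Proof.
move=> skl; pose D (i : nat) := (i + k < n.+1)%N && same_block s i (i + k)%N.
exists (\matrix_(i, j) (((i : nat) == j + k)%N && same_block s j i)%:R).
exists (\matrix_(i, j)
  (((j : nat) == i - l)%N && [&& l <= i, same_block s j i & ~~ D i]%N)%:R).
rewrite !jordan_exp; apply/matrixP => i j; rewrite !mxE.
under eq_bigr => m _ do rewrite !mxE.
under [in X in _ + X]eq_bigr => m _ do rewrite !mxE.
rewrite (sum_indicator _ _ _ (same_block s i)
  (fun m => (m == j + k)%N && same_block s j m)).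
rewrite (sum_indicator _ _ _ (fun m => [&& l <= i, same_block s m i & ~~ D i]%N)
  (fun m => (j == m + l :> nat)%N && same_block s m j)).
have Di : ~~ D i -> (l <= i)%N && same_block s (i - l) i.
  have [|a [m [/skl mk ai amn _ ends]]] := block_interval s i.
    by rewrite sum_s.
  have sb x y : (a <= x)%N -> (y < a + m)%N -> same_block s x y.
    by move=> ax ym; apply/hasPn => z /ends; lia.
  have [ik _|ik] := leqP (a + m) (i + k); first by rewrite sb; lia.
  by rewrite /D sb ?andbT; lia.
have [<-|ij] := eqVneq i j; last first.
  rewrite -val_eqE /= in ij; rewrite eqn_add2r (negPf ij) ?andbF add0r.
  case: (boolP (l <= i)%N) => li; rewrite ?andbF // subnK //.
  by rewrite eq_sym (negPf ij) !andbF.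
case: (boolP (D i)) => [Di1|Di0].
  by rewrite eqxx !andbF addr0 andTb andbb -/(D i) Di1.
have /andP[li sbi] := Di Di0.
rewrite eqxx andTb andbb -/(D i) (negPf Di0) add0r li sbi subnK // eqxx.
by rewrite (leq_ltn_trans (leq_subr _ _) (ltn_ord i)).
Qed.

End Jordan.

(** * The complement in gl_n, then in sl_n *)

Lemma centralizer_complement (F : numFieldType) (n d : nat)
    (e h f : 'M[F]_n.+1) :
    h * e = e * h + e *+ 2 -> e * f = f * e + h -> e ^+ d.+2 = 0 ->
    (forall k l, (k + l)%N = d.+1 -> exists X Y, 1 = e ^+ k * X + Y * e ^+ l) ->
  exists s : {vspace 'M[F]_n.+1},
    [/\ forall x y, x \in s -> y \in s -> lie x y \in s,
        forall x, x \in s -> lie h x \in s,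
        forall x, exists2 z, z * e = e * z & x - z \in s
      & forall x, x * e = e * x -> x \in s -> x = 0].
Proof.
move=> he ef nil_e split_e.
have [P [sumP hP Ph P_out PP]] := @spectral_projections F _ d.+2.*2 (wt F d) h
  isT (@wt_inj F d) (prod_h F _ h e f d he ef nil_e split_e).
have P01 : P 0%N * (1 - P 0%N) = 0 by rewrite mulrBr mulr1 PP subrr.
(* One linear map encodes both conditions: its summands start with the orthogonal projections [P 0]
   and [P 1], so they vanish separately. *)
pose theta := mulmx (P 0%N) \+ (mulmx (P 1%N) \o mulmxr (1 - P 0%N)).
have sE x : (x \in lker (linfun theta))
    = (P 0%N * x == 0) && (P 1%N * x * (1 - P 0%N) == 0).
  rewrite memv_ker lfunE /= !mulmxE mulrA.
  apply/eqP/andP => [x0|[/eqP-> /eqP->]]; last exact: addr0.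
  split; apply/eqP.
    move/(congr1 ( *%R (P 0%N))): x0.
    by rewrite mulrDr !mulrA !PP eqxx /= !mul0r addr0 mulr0.
  move/(congr1 ( *%R (P 1%N))): x0.
  by rewrite mulrDr !mulrA !PP eqxx /= mul0r add0r mulr0.
exists (lker (linfun theta)); split.
- move=> x y; rewrite !sE => /andP[/eqP x0 /eqP x1] /andP[/eqP y0 /eqP y1].
  (* Closure already holds for the associative product: U0 u = 0, and U1 u v lies in U0 v = 0. *)
  have mul u v : P 0%N * u = 0 -> P 1%N * u * (1 - P 0%N) = 0 -> P 0%N * v = 0 ->
      P 0%N * (u * v) = 0 /\ P 1%N * (u * v) = 0.
    move=> u0 u1 v0; rewrite !mulrA u0 mul0r; split=> //.
    move/eqP: u1; rewrite mulrBr mulr1 subr_eq0 => /eqP->.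
    by rewrite -mulrA v0 mulr0.
  rewrite /lie !mulmxE !(mulrBr (P _)).
  have [-> ->] := mul x y x0 x1 y0; have [-> ->] := mul y x y0 y1 x0.
  by rewrite !subr0 mul0r eqxx.
- move=> x; rewrite !sE => /andP[/eqP x0 /eqP x1].
  have hP0 : h * (1 - P 0%N) = (1 - P 0%N) * h.
    by rewrite mulrBr mulrBl mulr1 mul1r hP Ph.
  rewrite /lie !mulmxE !(mulrBr (P _)) mulrBl !mulrA x0 mul0r !Ph -!scalerAl x0 x1.
  by rewrite -[_ * h * _]mulrA hP0 mulrA x1 mul0r !scaler0 subr0 eqxx.
- move=> x; have [z [ze z0 z1]] := commuting_decomposition
    F _ h e f d he ef nil_e split_e P sumP hP Ph P_out PP x.
  by exists z; rewrite // sE z0 z1 eqxx.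
move=> x xe; rewrite sE => /andP[/eqP x0 /eqP x1].
exact: (commuting_eq0 F _ h e f d he ef nil_e split_e P sumP hP Ph P_out PP).
Qed.

(* Subtracting scalar matrices, which commute with e, moves a complement in gl_n
   into sl_n without changing brackets. *)
Lemma traceless_complement (F : numFieldType) (n : nat) (e h : 'M[F]_n)
    (s : {vspace 'M[F]_n}) :
    (forall x y, x \in s -> y \in s -> lie x y \in s) ->
    (forall x, x \in s -> lie h x \in s) ->
    (forall x, exists2 z, z * e = e * z & x - z \in s) ->
    (forall x, x * e = e * x -> x \in s -> x = 0) ->
  exists t : {vspace 'M[F]_n},
    [/\ (forall x, x \in t -> in_sl x),
        (forall x y, x \in t -> y \in t -> lie x y \in t),
        (forall x, x \in t -> lie h x \in t),
        (forall x, in_sl x ->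
           exists a b, [/\ in_centralizer e a, b \in t & x = a + b])
      & (forall x, in_centralizer e x -> x \in t -> x = 0)].
Proof.
move=> s_lie s_h s_sum s_dir.
pose c (x : 'M[F]_n) : F := \tr x / n%:R.
pose tau : 'M[F]_n -> 'M[F]_n := fun x => x - (c x)%:M.
have tau_linear : linear tau.
  move=> a x y; rewrite /tau /c linearP mulrDl -mulrA raddfD /= -scale_scalar_mx.
  by rewrite opprD addrACA -scalerBr.
pose taul := GRing.isLinear.Build _ _ _ _ tau tau_linear.
pose tauL : {linear 'M[F]_n -> 'M[F]_n} := HB.pack tau taul.
have tauE x : linfun tauL x = x - (c x)%:M by rewrite lfunE.
have tauD x y : tau (x + y) = tau x + tau y by apply: (linearD tauL).
have tr_tau x : \tr (tau x) = 0.
  rewrite /tau /c raddfB /= mxtrace_scalar -[_ *+ n]mulr_natr.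
  (* In size 0 every trace is 0; otherwise [n] is invertible. *)
  case: n x {e h s s_lie s_h s_sum s_dir c tau tau_linear taul tauL tauE tauD}
    => [|n] x; first by rewrite (flatmx0 x) mxtrace0 !mul0r subrr.
  by rewrite divfK ?subrr ?pnatr_eq0.
have tau_id x : \tr x = 0 -> tau x = x.
  by move=> x0; rewrite /tau /c x0 mul0r raddf0 subr0.
have tr_lie x y : \tr (@lie F n x y) = 0.
  by rewrite /lie raddfB /= mxtrace_mulC subrr.
have lieBl a x y : @lie F n (x - a%:M) y = lie x y.
  rewrite /lie mulmxBl mulmxBr mul_scalar_mx mul_mx_scalar opprB.
  by rewrite addrA subrK.
have lieBr a x y : @lie F n x (y - a%:M) = lie x y.
  rewrite /lie mulmxBl mulmxBr mul_scalar_mx mul_mx_scalar opprB.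
  by rewrite addrA subrK.
have tau_mem x : x \in s -> \tr x = 0 -> x \in (linfun tauL @: s)%VS.
  by move=> xs x0; apply/memv_imgP; exists x; rewrite // lfunE /= tau_id.
exists (linfun tauL @: s)%VS; split.
- by move=> _ /memv_imgP[x _ ->]; rewrite lfunE; apply: tr_tau.
- move=> _ _ /memv_imgP[x xs ->] /memv_imgP[y ys ->].
  by rewrite !tauE lieBl lieBr tau_mem ?s_lie.
- by move=> _ /memv_imgP[x xs ->]; rewrite tauE lieBr tau_mem ?s_h.
- move=> x x0; have [z ze xz] := s_sum x.
  exists (tau z), (tau (x - z)); split; last first.
  + by rewrite -tauD addrC subrK tau_id.
  + by rewrite -[tau _](lfunE tauL) memv_img.
  by split; [apply: tr_tau | rewrite lieBl /lie !mulmxE ze subrr].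
move=> y [_ xe] /memv_imgP[x xs yE]; rewrite {y}yE tauE in xe *.
move: xe; rewrite lieBl /lie !mulmxE => /eqP; rewrite subr_eq0 => /eqP xe.
by rewrite (s_dir x xe xs) /c raddf0 mul0r raddf0 subrr.
Qed.

(* C := R[i] with R : realType, i.e. the complex numbers. *)
Theorem theorem3p4 (R : realType) (n : nat) (p : seq nat)
  (hp : is_partition n p)
  (hdiff : forall i j, i \in p -> j \in p -> (i <= j.+1)%N)
  (e h f : 'M[R[i]]_n)
  (he : in_nilorbit p e)
  (htriple : sl2_triple h e f) :
  exists s : {vspace 'M[R[i]]_n},
    [/\ (* s is contained in sl_n *)
        (forall x, x \in s -> in_sl x),
        (* s is a Lie subalgebra *)
        (forall x y, x \in s -> y \in s -> lie x y \in s),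
        (* s is ad h-invariant *)
        (forall x, x \in s -> lie h x \in s),
        (* sl_n = g^e + s *)
        (forall x, in_sl x ->
           exists a b, [/\ in_centralizer e a, b \in s & x = a + b])
      & (* the sum is direct *)
        (forall x, in_centralizer e x -> x \in s -> x = 0)].
Proof.
have [_ [lie_he _ lie_ef]] := htriple.
suff [s [s_lie s_h s_sum s_dir]] : exists s : {vspace 'M[R[i]]_n},
    [/\ forall x y, x \in s -> y \in s -> lie x y \in s,
        forall x, x \in s -> lie h x \in s,
        forall x, exists2 z, z * e = e * z & x - z \in s
      & forall x, x * e = e * x -> x \in s -> x = 0].
  exact: traceless_complement s_lie s_h s_sum s_dir.
(* For [e = 0] the commutant is everything and the complement is 0. Otherwise the largest part is at
   least 2, hence of the form [d + 2]. *)
have [e0|] := eqVneq e 0.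
  exists 0%VS; split.
  - by move=> x y; rewrite !memv0 => /eqP-> /eqP->; rewrite /lie !mul0mx subrr.
  - by move=> x; rewrite !memv0 => /eqP->; rewrite /lie mul0mx mulmx0 subrr.
  - by move=> x; exists x; rewrite ?subrr ?mem0v // e0 mulr0 mul0r.
  by move=> x _; rewrite memv0 => /eqP.
case: n hp e h f he htriple lie_he lie_ef
  => [|n] hp e h f he htriple lie_he lie_ef e_neq0.
  by case/eqP: e_neq0; apply: flatmx0.
have /and3P[_ p_sorted /eqP sum_p] := hp.
have [U U_unit eE] := he.
have UV : U * invmx U = 1 by apply: mulmxV.
have VU : invmx U * U = 1 by apply: mulVmx.
have e_exp k : e ^+ k = invmx U * jordan_nil _ n.+1 p ^+ k * U.
  elim: k => [|k IH]; first by rewrite !expr0 mulr1 VU.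
  rewrite exprSr IH [in LHS]eE !mulmxE exprSr -!mulrA; congr (_ * (_ * _)).
  by rewrite !mulrA UV mul1r.
have [m [m_p p_le]] : exists m, m \in p /\ forall i, i \in p -> (i <= m)%N.
  case: p p_sorted sum_p {hp hdiff he eE e_exp} => // m p /= pm _.
  exists m; rewrite mem_head; split=> // i; rewrite inE => /orP[/eqP->//|].
  move: i; apply/allP; apply: order_path_min pm => x y z /= yx zy.
  exact: leq_trans zy yx.
have e_nil k : (m <= k)%N -> e ^+ k = 0.
  move=> mk; rewrite e_exp jordan_exp_eq0 ?mulr0 ?mul0r // => i /p_le im.
  exact: leq_trans im mk.
case: m m_p p_le e_nil => [|[|d]] m_p p_le e_nil.
- by case/eqP: e_neq0; rewrite -[e]expr1 e_nil.
- by case/eqP: e_neq0; rewrite -[e]expr1 e_nil.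
have e_split k l : (k + l)%N = d.+1 -> exists X Y, 1 = e ^+ k * X + Y * e ^+ l.
  move=> kl; have [|X [Y XY]] := jordan_split R[i] n p sum_p k l.
    (* Comparison with the largest part [d + 2] bounds every part below by [d + 1]. *)
    by move=> i ip; rewrite kl -ltnS; apply: hdiff.
  exists (invmx U * X * U), (invmx U * Y * U); rewrite !e_exp.
  have conjM Z Z' : invmx U * Z * U * (invmx U * Z' * U) = invmx U * (Z * Z') * U.
    by rewrite -!mulrA [U * (invmx U * _)]mulrA UV mul1r.
  by rewrite !conjM -mulrDl -mulrDr -XY mulr1 VU.
have heE : h * e = e * h + e *+ 2.
  by apply/eqP; rewrite -subr_eq0 opprD addrA -scaler_nat -lie_he subrr.
have efE : e * f = f * e + h by rewrite -lie_ef /lie !mulmxE addrC subrK.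
exact: centralizer_complement heE efE (e_nil _ (leqnn _)) e_split.
Qed.
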